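(* Let $M$ be an oriented closed connected manifold and let $F$ and $E$ be fields of the same characteristic. Then $$\|M\|_{(F)} = \|M\|_{(E)}.$$
   Context: Closed means compact without boundary. Let $R$ be a commutative ring with unit and let $M$ be an oriented closed connected $n$-manifold. An $R$-fundamental cycle of $M$ is a singular cycle in $C_n(M;R)$ representing the $R$-fundamental class $[M]_R \in H_n(M;R)$, the image of the integral fundamental class under $\mathbb{Z}\to R$. The weightless $R$-simplicial volume of $M$ is $$\|M\|_{(R)} := \min\Bigl\{ m \in \mathbb{N} \Bigm| \sum_{j=1}^m a_j\cdot\sigma_j \in C_n(M;R) \text{ is an } R\text{-fundamental cycle of } M\Bigr\}.$$ *)

(* Defs.v *)
From HB Require Import structures.
From mathcomp Require Import all_boot all_order all_algebra.
From mathcomp Require Import all_classical all_reals topology normedtype.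
From mathcomp Require Import freeg.

Set Implicit Arguments.
Unset Strict Implicit.
Unset Printing Implicit Defensive.

Import Order.TTheory GRing.Theory Num.Theory.
Import numFieldNormedType.Exports.

Local Open Scope classical_set_scope.
Local Open Scope ring_scope.

Definition homeomorphic (X Y : topologicalType) : Prop :=
  exists (f : X -> Y) (g : Y -> X),
    [/\ continuous f, continuous g, cancel f g & cancel g f].

(* Here and below, [K] is the field of real numbers. *)
Definition locally_euclidean (K : realType) (n : nat) (M : topologicalType) :=
  forall x : M, exists U : set M,
    [/\ open U, U x & homeomorphic (set_type U) 'rV[K]_n].

Definition manifold (K : realType) (n : nat) (M : topologicalType) : Prop :=
  [/\ hausdorff_space M, @second_countable M & locally_euclidean K n M].

(* The library's [connected] holds of the empty set, hence the separate
   nonemptiness clause. *)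
Definition closed_connected_manifold (K : realType) (n : nat)
    (M : topologicalType) : Prop :=
  [/\ manifold K n M, compact [set: M], connected [set: M] &
      [set: M] !=set0].

Definition std_simplex (K : realType) (n : nat) : set 'rV[K]_n.+1 :=
  [set t | (forall i, 0 <= t 0 i) /\ \sum_i t 0 i = 1].

(* The affine map sending the j-th vertex to the (lift i j)-th one, in
   barycentric coordinates: a 0 is inserted in position [i]. *)
Definition coface_row (K : realType) n (i : 'I_n.+2) (t : 'rV[K]_n.+1) :
    'rV[K]_n.+2 :=
  \row_j oapp (t 0) 0 (unlift i j).

Lemma coface_row_simplex (K : realType) n (i : 'I_n.+2)
    (t : set_type (@std_simplex K n)) :
  coface_row i (val t) \in @std_simplex K n.+1.
Proof.
have [t0 t1] : std_simplex (val t) by apply/set_mem; exact: valP.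
apply/mem_set; split=> [j|].
  by rewrite mxE; case: unliftP => [k _|_] /=.
rewrite (bigD1_ord i) //= mxE unlift_none add0r -[RHS]t1.
by apply: eq_bigr => j _; rewrite mxE liftK.
Qed.

Definition coface (K : realType) n (i : 'I_n.+2) :
    set_type (@std_simplex K n) -> set_type (@std_simplex K n.+1) :=
  fun t => exist _ (coface_row i (val t)) (coface_row_simplex i t).

Lemma coface_row_continuous (K : realType) n (i : 'I_n.+2) :
  continuous (@coface_row K n i).
Proof.
move=> t B [P tP PB].
exists (fun _ k => P ord0 (fintype.lift i k)) => [a k|s sP].
  by rewrite ord1; move: (tP ord0 (fintype.lift i k)); rewrite mxE liftK.
apply: PB => a j; rewrite ord1 mxE; move: (tP ord0 j); rewrite mxE.
case: unliftP => [k ->|_] /= jP; first exact: sP.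
exact: nbhs_singleton.
Qed.

Lemma coface_continuous (K : realType) n (i : 'I_n.+2) :
  continuous (@coface K n i).
Proof.
apply/continuous_comp_initial => t.
apply: (@continuous_comp _ _ _ set_val (@coface_row K n i)).
  exact: initial_continuous.
exact: coface_row_continuous.
Qed.

HB.instance Definition _ (K : realType) n (i : 'I_n.+2) :=
  isContinuous.Build _ _ (@coface K n i) (@coface_continuous K n i).

Definition sing_simplex (K : realType) (M : topologicalType) (n : nat) :
    choiceType :=
  continuousType (set_type (@std_simplex K n)) M.

Definition face (K : realType) (M : topologicalType) n (i : 'I_n.+2)
    (s : sing_simplex K M n.+1) : sing_simplex K M n :=
  s \o coface i.

Section SingularHomology.
Variables (K : realType) (M : topologicalType).

Definition chain (R : comNzRingType) (n : nat) := {freeg (sing_simplex K M n) / R}.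

(* The boundary is 0 in degree 0, where the target degree 0.-1 is 0. *)
Definition boundary (R : comNzRingType) (n : nat) : chain R n -> chain R n.-1 :=
  match n with
  | 0 => fun=> 0
  | m.+1 => fglift (fun s : sing_simplex K M m.+1 =>
              \sum_(i < m.+2) (<< (-1) ^+ i *g face i s >> : chain R m))
  end.

Definition sing_cycle (R : comNzRingType) n (c : chain R n) : Prop :=
  boundary c = 0.

Definition homologous (R : comNzRingType) n (c c' : chain R n) : Prop :=
  exists b : chain R n.+1, c - c' = boundary b.

Definition supported (R : comNzRingType) n (A : set M) (c : chain R n) : Prop :=
  forall s : sing_simplex K M n, s \in dom c -> range s `<=` A.

Definition rel_cycle (R : comNzRingType) n (A : set M) (c : chain R n) : Prop :=
  supported A (boundary c).

Definition rel_homologous (R : comNzRingType) n (A : set M) (c c' : chain R n) :=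
  exists b : chain R n.+1, supported A (c - c' - boundary b).

(* Elements of H_n(M, A; R) are represented by their sets of relative cycles. *)
Definition rel_homology_class (R : comNzRingType) n (A : set M) (c : chain R n) :
    set (chain R n) :=
  [set c' | rel_cycle A c' /\ rel_homologous A c' c].

Definition generates_rel_homology n (A : set M) (h : set (chain int n)) :=
  exists g : chain int n,
    [/\ rel_cycle A g, h = rel_homology_class A g &
        forall c : chain int n, rel_cycle A c ->
          exists k : int, rel_homologous A c (g *~ k)].

Definition change_coeff (R : comNzRingType) n (c : chain int n) : chain R n :=
  \sum_(s <- dom c) << (coeff s c)%:~R *g s >>.

End SingularHomology.

(* A locally consistent choice of generators of the groups H_n(M, M - x; Z). *)
Record orientation (K : realType) (n : nat) (M : topologicalType) :=
  Orientation {
    local_class : M -> set (chain K M int n);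
    local_class_generates : forall x : M,
      generates_rel_homology (~` [set x]) (local_class x);
    local_class_coherent : forall x : M, exists2 U : set M, nbhs x U &
      exists2 c : chain K M int n, rel_cycle (~` U) c &
        forall y, U y -> local_class y c
  }.

Section WeightlessVolume.
Variables (K : realType) (n : nat) (M : topologicalType).
Variable o : orientation K n M.

(* The fundamental class of a closed connected manifold is the unique element
   of H_n(M; Z) restricting to the given generator of H_n(M, M - x; Z) for all
   x; it is represented by the set of its cycles. *)
Definition fundamental_class : set (chain K M int n) :=
  [set z | sing_cycle z /\ forall x, local_class o x z].

Definition fundamental_class_in (R : comNzRingType) : set (chain K M R n) :=
  [set c | sing_cycle c /\
    exists2 z, fundamental_class z & homologous c (change_coeff R z)].

Definition fundamental_cycle_length (R : comNzRingType) : set nat :=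
  [set m | exists (a : 'I_m -> R) (s : 'I_m -> sing_simplex K M n),
    fundamental_class_in (\sum_(j < m) << a j *g s j >>)].

(* The minimum of [fundamental_cycle_length R], which is nonempty because the
   fundamental class of a closed connected oriented manifold exists; [xget]
   needs a default value, which is 0. *)
Definition weightless_simplicial_volume (R : comNzRingType) : nat :=
  xget 0%N [set m | fundamental_cycle_length R m /\
                    forall k, fundamental_cycle_length R k -> (m <= k)%N].

End WeightlessVolume.

(* Main.v *)
Require Import Defs.
From mathcomp Require Import all_boot all_order all_algebra.
From mathcomp Require Import all_classical all_reals topology.
From HB Require Import structures.
From mathcomp Require Import freeg ring.

(** The two volumes agree because both fields allow the same lengths of
    fundamental cycles, and this holds because an additive map [phi : F -> E]
    with [phi 1 = 1] exists as soon as [F] and [E] have the same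
    characteristic ([exists_unital_additive_map]).

    Applying [phi] to every coefficient of a chain commutes with the boundary,
    which has integer coefficients, and it sends the image in [F] of an
    integral chain to its image in [E], since [phi] is the identity on
    integers.  Hence a relation [c - z = boundary b] over [F], with [z] an
    integral fundamental cycle, becomes such a relation over [E]; and a sum of
    [m] terms remains a sum of [m] terms.  Exchanging [F] and [E] gives the
    other inclusion.

    To find [phi], view [F] as a vector space over its prime field [k] and
    choose a [k]-hyperplane [H] that does not contain 1; then [F] is the direct
    sum of [H] and [k], and [phi] is the projection onto [k] followed by the
    embedding of [k] into [E], which exists because the characteristics
    agree.  Elements of [k] are written as quotients of integers, so that a
    [k]-subspace is a subgroup closed under division by the integers that are
    invertible in [F]. *)

Set Implicit Arguments.
Unset Strict Implicit.
Unset Printing Implicit Defensive.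

Import GRing.Theory.

Local Open Scope classical_set_scope.
Local Open Scope ring_scope.

Lemma pchar_eq_intr0 (F E : fieldType) : [pchar F] =i [pchar E] ->
  forall k : int, (k%:~R == 0 :> F) = (k%:~R == 0 :> E).
Proof.
move=> FE; suff nat_case (k : nat) : (k%:R == 0 :> F) = (k%:R == 0 :> E).
  by case=> k; rewrite ?NegzE ?rmorphN ?oppr_eq0 /= ?pmulrn nat_case.
apply: negb_inj; rewrite !natf_neq0_pchar; exact/eq_pnat/eq_negn.
Qed.

Lemma subgroup_mulz (R : pzRingType) (H : set R) :
  H 0 -> (forall x y, H x -> H y -> H (x - y)) ->
  forall (k : int) x, H x -> H (k%:~R * x).
Proof.
move=> H0 subH k x Hx; have oppH y : H y -> H (- y).
  by move=> Hy; rewrite -sub0r; exact: subH.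
have mulnH (p : nat) : H (p%:R * x).
  elim: p => [|p IHp]; first by rewrite mul0r.
  by rewrite -natr1 mulrDl mul1r -[x in _ + x]opprK; exact/subH/oppH.
case: k => p; first exact: mulnH.
by rewrite NegzE rmorphN mulNr; exact/oppH/mulnH.
Qed.

(** Subspaces over the prime field that avoid 1; the empty set is included so
    that the union of any chain qualifies, even that of the empty chain. *)
Definition avoiding_subspace (F : fieldType) (H : set F) : Prop :=
  [/\ forall x y, H x -> H y -> H (x - y),
      forall (b : int) x, b%:~R != 0 :> F -> H (b%:~R * x) -> H x &
      ~ H 1].

Lemma exists_maximal_avoiding_subspace (F : fieldType) :
  exists H : set F, avoiding_subspace H /\
    forall H', H `<` H' -> ~ avoiding_subspace H'.
Proof.
apply: Zorn_bigcup => C CP Ctot; split.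
- move=> x y [X CX Xx] [Y CY Yy].
  have [XY|YX] := Ctot _ _ CX CY.
    by exists Y => //; have [+ _ _] := CP _ CY; apply=> //; exact: XY.
  by exists X => //; have [+ _ _] := CP _ CX; apply=> //; exact: YX.
- move=> b x b0 [X CX Xx]; exists X => //.
  by have [_ + _] := CP _ CX; apply; eassumption.
- by case=> X CX X1; have [_ _] := CP _ CX; apply.
Qed.

(** The maximal subspace avoiding 1 is a complement to the prime field: every
    [x] is congruent to some quotient [b / m] modulo [H], as otherwise the
    span of [H] and [x] would still avoid 1. *)
Lemma prime_field_complement (F : fieldType) :
  exists H : set F, [/\ avoiding_subspace H, H 0 &
    forall x, exists mb : int * int,
      mb.1%:~R != 0 :> F /\ H (mb.1%:~R * x - mb.2%:~R)].
Proof.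
have [H [avoidH maxH]] := exists_maximal_avoiding_subspace F.
have [subH pureH H1] := avoidH.
have H0 : H 0.
  (* A set without 0 that is closed under subtraction is empty, so {0} would
     extend it. *)
  apply: contrapT => nH0; apply: (maxH [set 0]).
    split=> [x Hx|/(_ 0 erefl)//]; exfalso; apply: nH0.
    by rewrite -(subrr x); exact: subH.
  split=> [x y -> ->|b x b0 /eqP|/eqP].
  - by rewrite /= subr0.
  - by rewrite mulf_eq0 (negbTE b0) => /eqP.
  - by rewrite oner_eq0.
have oppH x : H x -> H (- x) by move=> Hx; rewrite -sub0r; exact: subH.
have mulzH := subgroup_mulz H0 subH.
exists H; split=> // x; apply: contrapT => nx.
have noH (m b : int) : m%:~R != 0 :> F -> ~ H (m%:~R * x - b%:~R).
  by move=> m0 Hmb; apply: nx; exists (m, b).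
(* The span of [H] and [x]. *)
pose H' := [set y | exists b m : int,
  b%:~R != 0 :> F /\ H (b%:~R * y - m%:~R * x)].
apply: (maxH H'); split.
- move=> y Hy; exists 1, 0; split; first exact: oner_neq0.
  by rewrite mul1r mul0r subr0.
- move=> H'H; apply: (noH 1 0); first exact: oner_neq0.
  rewrite mul1r subr0; apply: H'H; exists 1, 1; split; first exact: oner_neq0.
  by rewrite subrr.
- move=> y z [b [m [b0 Hy]]] [c [p [c0 Hz]]].
  exists (b * c), (m * c - p * b); split; first by rewrite rmorphM mulf_neq0.
  have := subH _ _ (mulzH c _ Hy) (mulzH b _ Hz).
  by congr H; rewrite !(rmorphB, rmorphM) /=; ring.
- move=> c y c0 [b [m [b0 Hy]]]; exists (b * c), m.
  by rewrite rmorphM mulf_neq0//=; split=> //; move: Hy; rewrite mulrA.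
- case=> b [m [b0 Hbm]]; have [m0|m0] := eqVneq (m%:~R : F) 0.
    by apply/H1/(pureH b) => //; move: Hbm; rewrite m0 mul0r subr0.
  by apply: (noH m b m0); rewrite -opprB -[b%:~R]mulr1; exact: oppH.
Qed.

Lemma exists_unital_additive_map (F E : fieldType) : [pchar F] =i [pchar E] ->
  exists phi : {additive F -> E}, phi 1 = 1.
Proof.
move=> /pchar_eq_intr0 FE0.
have [H [[subH pureH H1] H0 decH]] := prime_field_complement F.
have mulzH := subgroup_mulz H0 subH.
(* The fraction [b / m] attached to [x] is well defined in [E]: the cross
   difference of two choices lies in [H], so it vanishes in [F], as otherwise
   dividing by it would put 1 in [H]. *)
have uniqE (m b m' b' : int) x : m%:~R != 0 :> F -> m'%:~R != 0 :> F ->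
    H (m%:~R * x - b%:~R) -> H (m'%:~R * x - b'%:~R) ->
    b%:~R / m%:~R = b'%:~R / m'%:~R :> E.
  move=> m0 m'0 Hx Hx'.
  have : (b * m' - b' * m)%:~R == 0 :> F.
    apply: contra_notT H1 => bm0; apply: (pureH (b * m' - b' * m)) => //.
    have := subH _ _ (mulzH m _ Hx') (mulzH m' _ Hx).
    by congr H; rewrite !(rmorphB, rmorphM) /=; ring.
  rewrite FE0 rmorphB !rmorphM subr_eq0 /= => /eqP bm.
  by apply/eqP; rewrite eqr_div -?FE0// bm.
have [f fP] := choice decH.
(* The projection of [F] onto its prime field along [H], read in [E]. *)
pose phi x : E := (f x).2%:~R / (f x).1%:~R.
have phiP x (m b : int) : m%:~R != 0 :> F -> H (m%:~R * x - b%:~R) ->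
    phi x = b%:~R / m%:~R.
  by move=> m0 Hx; have [f0 Hf] := fP x; exact: uniqE Hf Hx.
have phiB : {morph phi : x y / x - y}.
  move=> x y; have [[mx0 Hx] [my0 Hy]] := (fP x, fP y).
  rewrite (phiP _ ((f x).1 * (f y).1)
                  ((f x).2 * (f y).1 - (f y).2 * (f x).1)).
  - have [mx0E my0E] : (f x).1%:~R != 0 :> E /\ (f y).1%:~R != 0 :> E.
      by rewrite -!FE0.
    by rewrite /phi !(rmorphB, rmorphM) /=; field; rewrite my0E mx0E.
  - by rewrite rmorphM mulf_neq0.
  - have := subH _ _ (mulzH (f y).1 _ Hx) (mulzH (f x).1 _ Hy).
    by congr H; rewrite !(rmorphB, rmorphM) /=; ring.
pose phi' : {additive F -> E} := HB.pack phi
  (GRing.isZmodMorphism.Build F E phi phiB).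
exists phi'; rewrite /= (phiP 1 1 1) ?divr1 ?oner_neq0//.
by rewrite mulr1 subrr.
Qed.

Lemma scale_freegU (R : nzRingType) (T : choiceType) (a b : R) (x : T) :
  a *: << b *g x >> = << a * b *g x >> :> {freeg T / R}.
Proof. by apply/eqP/freeg_eqP => y; rewrite coeffZ !coeffU mulrA. Qed.

Section MapCoeff.
Variables (R S : nzRingType) (T : choiceType) (phi : {additive R -> S}).

Definition map_coeff (D : {freeg T / R}) : {freeg T / S} :=
  \sum_(x <- dom D) << phi (coeff x D) *g x >>.

Lemma coeff_map_coeff x D : coeff x (map_coeff D) = phi (coeff x D).
Proof.
rewrite -[in RHS](freeg_sumE D) !raddf_sum /=; apply: eq_bigr => y _.
by rewrite !coeffU; case: (y == x); rewrite ?mulr1 ?mulr0 ?raddf0.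
Qed.

Lemma map_coeff_is_additive : {morph map_coeff : D1 D2 / D1 - D2}.
Proof.
move=> D1 D2; apply/eqP/freeg_eqP => x.
by rewrite coeffB !coeff_map_coeff coeffB raddfB.
Qed.

HB.instance Definition _ := GRing.isZmodMorphism.Build
  {freeg T / R} {freeg T / S} map_coeff map_coeff_is_additive.

Lemma map_coeffU a x : map_coeff << a *g x >> = << phi a *g x >>.
Proof.
apply/eqP/freeg_eqP => y; rewrite coeff_map_coeff !coeffU.
by case: (x == y); rewrite ?mulr1 ?mulr0 ?raddf0.
Qed.

End MapCoeff.

Section ChangeOfField.
Variables (K : realType) (M : topologicalType) (R S : comNzRingType).
Variable phi : {additive R -> S}.

Lemma boundary_is_additive (A : comNzRingType) n :
  {morph @boundary K M A n : c d / c - d}.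
Proof. by case: n => [|n] c d /=; rewrite ?subr0 // lift_is_additive. Qed.

HB.instance Definition _ (A : comNzRingType) n :=
  GRing.isZmodMorphism.Build (chain K M A n) (chain K M A n.-1)
    (@boundary K M A n) (@boundary_is_additive A n).

(** Only the signs [(-1) ^+ i] multiply coefficients in the boundary, and an
    additive map commutes with signs. *)
Lemma boundary_map_coeff n (c : chain K M R n) :
  boundary (map_coeff phi c : chain K M S n) = map_coeff phi (boundary c).
Proof.
elim/freeg_ind_dom0: c => [|a s c _ _ IHc]; first by rewrite !raddf0.
rewrite !raddfD /= IHc map_coeffU; congr (_ + _).
case: n s {c IHc} => [|n] s /=; first by rewrite raddf0.
rewrite !liftU !scaler_sumr raddf_sum; apply: eq_bigr => i _ /=.
by rewrite !scale_freegU map_coeffU [a * _]mulrC raddfMsign mulrC.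
Qed.

Hypothesis phi1 : phi 1 = 1.

Lemma change_coeff_map_coeff n (z : chain K M int n) :
  map_coeff phi (change_coeff R z) = change_coeff S z.
Proof.
rewrite raddf_sum; apply: eq_bigr => s _ /=.
by rewrite map_coeffU raddfMz phi1.
Qed.

Lemma fundamental_class_in_map_coeff n (o : orientation K n M) (c : chain K M R n) :
  fundamental_class_in o c ->
  fundamental_class_in o (map_coeff phi c : chain K M S n).
Proof.
case=> cyc [z oz [b cb]]; split.
  by rewrite /sing_cycle boundary_map_coeff cyc raddf0.
exists z => //; exists (map_coeff phi b).
by rewrite boundary_map_coeff -cb raddfB /= change_coeff_map_coeff.
Qed.

Lemma fundamental_cycle_length_map n (o : orientation K n M) :
  fundamental_cycle_length o R `<=` fundamental_cycle_length o S.
Proof.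
move=> m [a [s /fundamental_class_in_map_coeff]].
rewrite raddf_sum => om; exists (phi \o a), s; move: om.
by congr fundamental_class_in; apply: eq_bigr => j _; rewrite /= map_coeffU.
Qed.

End ChangeOfField.

Theorem theorem3p8 (K : realType) (n : nat) (M : topologicalType)
  (hM : closed_connected_manifold K n M) (o : orientation K n M)
  (F E : fieldType) (hchar : [pchar F] =i [pchar E]) :
  weightless_simplicial_volume o F = weightless_simplicial_volume o E.
Proof.
have hchar' : [pchar E] =i [pchar F] by move=> p; rewrite hchar.
have [phi phi1] := exists_unital_additive_map hchar.
have [psi psi1] := exists_unital_additive_map hchar'.
rewrite /weightless_simplicial_volume.
suff -> : fundamental_cycle_length o F = fundamental_cycle_length o E by [].
apply/seteqP; split.
  exact: (fundamental_cycle_length_map phi1 (o := o)).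
exact: (fundamental_cycle_length_map psi1 (o := o)).
Qed.
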